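(* For each integer $n\ge 1$, let $S^1_n$ be the set of $n$ evenly-spaced points on the unit circle $S^1$, equipped with the arc-length (geodesic) distance. There exist real numbers $a_{j,n}$ (for $j$ an odd positive integer and $n\ge 1$) with $$\lim_{n\to\infty} a_{j,n}=\frac{\sqrt{2}}{j}\qquad\text{for every odd } j\ge 1,$$ such that the following holds. For all integers $m\ge 1$ and $n\ge 1$ such that the doubly mean-centered matrix $\mathbf{B}$ of $S^1_n$ has at least $m$ positive eigenvalues (counted with multiplicity), the classical MDS embedding of $S^1_n$ into $\mathbb{R}^m$ lies, up to a rigid motion of $\mathbb{R}^m$, on the curve $\gamma_m\colon S^1\to\mathbb{R}^m$ given by the first $m$ coordinates of $$\gamma_m(\theta)=\bigl(a_{1,n}\cos\theta,\ a_{1,n}\sin\theta,\ a_{3,n}\cos 3\theta,\ a_{3,n}\sin 3\theta,\ a_{5,n}\cos 5\theta,\ a_{5,n}\sin 5\theta,\ldots\bigr)\in\mathbb{R}^m .$$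
   Context: The unit circle $S^1=\mathbb{R}/2\pi\mathbb{Z}$ is parametrized by the angle $\theta$, and the arc-length distance between two points is the length of the shortest arc between them. The set $S^1_n$ consists of the points with angles $2\pi i/n$, $i=0,\dots,n-1$. Classical multidimensional scaling (MDS): Given an $n\times n$ symmetric matrix of distances $\mathbf{D}=(d_{ij})$, let $\mathbf{A}=(a_{ij})$ with $a_{ij}=-\tfrac12 d_{ij}^2$, and let $\mathbf{B}=(b_{rs})$ be the double mean-centering of $\mathbf{A}$, $$b_{rs}=a_{rs}-\frac1n\sum_{t=1}^n a_{rt}-\frac1n\sum_{t=1}^n a_{ts}+\frac1{n^2}\sum_{t,u=1}^n a_{tu}.$$ Write $\mathbf{B}=\mathbf{\Gamma}\mathbf{\Lambda}\mathbf{\Gamma}^\top$ with $\mathbf{\Gamma}$ orthogonal (its columns are unit-length eigenvectors of $\mathbf{B}$) and $\mathbf{\Lambda}$ diagonal with the eigenvalues of $\mathbf{B}$ in decreasing order. Suppose $\mathbf{B}$ has at least $m$ positive eigenvalues. Let $\mathbf{\Lambda}_m$ be the $m\times m$ diagonal matrix of the $m$ largest eigenvalues and $\mathbf{\Gamma}_m$ the $n\times m$ matrix of the corresponding columns of $\mathbf{\Gamma}$. A classical MDS embedding into $\mathbb{R}^m$ consists of the $n$ points of $\mathbb{R}^m$ given by the rows of $\mathbf{X}=\mathbf{\Gamma}_m\mathbf{\Lambda}_m^{1/2}$; the $i$-th row is the image of the $i$-th point. (It depends on the choice of orthonormal eigenvectors.) A rigid motion of $\mathbb{R}^m$ is an isometry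 of $\mathbb{R}^m$ (reflections allowed). *)

(* Defs.v *)
From HB Require Import structures.
From mathcomp Require Import all_boot all_order all_algebra.
From mathcomp Require Import all_classical all_reals all_analysis.

Set Implicit Arguments.
Unset Strict Implicit.
Unset Printing Implicit Defensive.

Import Order.TTheory GRing.Theory Num.Theory.
Import numFieldNormedType.Exports.

Local Open Scope classical_set_scope.
Local Open Scope ring_scope.

(* Points of S^1 = R / 2 pi Z are given by angles s, t : R. The arcs joining
   them lift to segments from s to some t + 2 k pi, so the shortest one has
   length min_k |s - t - 2 k pi|. *)
Definition arc_dist (R : realType) (s t : R) : R :=
  inf [set `|s - t - (2 * pi) *~ k| | k in [set: int]].

Definition circle_pt (R : realType) (n : nat) (i : 'I_n) : R :=
  2 * pi * i%:R / n%:R.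

Definition circle_dist_mx (R : realType) (n : nat) : 'M[R]_n :=
  \matrix_(i, j) arc_dist (circle_pt R i) (circle_pt R j).

Definition mds_A (R : realType) (n : nat) (D : 'M[R]_n) : 'M[R]_n :=
  \matrix_(i, j) (- (1 / 2) * D i j ^+ 2).

Definition double_center (R : realType) (n : nat) (A : 'M[R]_n) : 'M[R]_n :=
  \matrix_(r, s) (A r s - 1 / n%:R * (\sum_(t < n) A r t)
                        - 1 / n%:R * (\sum_(t < n) A t s)
                        + 1 / n%:R ^+ 2 * (\sum_(t < n) \sum_(u < n) A t u)).

Definition mds_B (R : realType) (n : nat) (D : 'M[R]_n) : 'M[R]_n :=
  double_center (mds_A D).

(* Eigenvalues are counted with their multiplicity in the characteristic
   polynomial. *)
Definition at_least_pos_eigenvalues (R : realType) (m n : nat) (B : 'M[R]_n)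
    : Prop :=
  exists s : seq R, [/\ size s = m, all (fun x => 0 < x) s
                      & \prod_(x <- s) ('X - x%:P) %| char_poly B].

Definition sorted_eigendecomposition (R : realType) (n : nat)
    (B G : 'M[R]_n) (L : 'rV[R]_n) : Prop :=
  [/\ G^T *m G = 1%:M,
      B = G *m diag_mx L *m G^T
    & forall i j : 'I_n, (i <= j)%N -> L 0 j <= L 0 i].

(* A relation rather than a function, since the embedding depends on the choice
   of the orthonormal eigenvectors. It is meant for matrices [mds_B D] with at
   least m positive eigenvalues: [Num.sqrt] is 0 on negative numbers. *)
Definition classical_mds (R : realType) (m n : nat) (D : 'M[R]_n)
    (X : 'M[R]_(n, m)) : Prop :=
  exists (G : 'M[R]_n) (L : 'rV[R]_n) (le_mn : (m <= n)%N),
    sorted_eigendecomposition (mds_B D) G L /\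
    X = colsub (widen_ord le_mn) G
        *m diag_mx (\row_(k < m) Num.sqrt (L 0 (widen_ord le_mn k))).

(* The library norm on 'rV[R]_m is the sup norm, not the Euclidean one. *)
Definition eucl_dist (R : realType) (m : nat) (x y : 'rV[R]_m) : R :=
  Num.sqrt (\sum_(k < m) (x 0 k - y 0 k) ^+ 2).

Definition rigid_motion (R : realType) (m : nat) (f : 'rV[R]_m -> 'rV[R]_m)
    : Prop :=
  forall x y, eucl_dist (f x) (f y) = eucl_dist x y.

(* With k counted from 0, coordinates k = j - 1 and k = j (j odd) are
   c j * cos (j theta) and c j * sin (j theta). *)
Definition gamma (R : realType) (c : nat -> R) (m : nat) (theta : R)
    : 'rV[R]_m :=
  \row_(k < m) (let j := ((k./2).*2.+1)%N in
                c j * (if odd k then sin (j%:R * theta)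
                       else cos (j%:R * theta))).

(* Main.v *)
(* The matrix B is circulant, so the waves cos (2 pi k t / n + psi) are its
   eigenvectors, with eigenvalue [eig n k]. The squared distance from 0 along the
   cycle has constant second difference except at the antipode, and summation
   by parts gives a closed form: the eigenvalue vanishes at k = 0, is positive
   exactly when the smaller of k and n - k is odd, and decreases along the odd
   frequencies up to n / 2.
   So the positive eigenvalues in decreasing order belong to the frequencies
   1, 1, 3, 3, 5, 5, ... (only once for n / 2), and any orthonormal eigenvectors
   G of B differ from the normalized cosines and sines U by the orthogonal matrix
   G^T U, which commutes with the diagonal of eigenvalues. If m cuts an eigenspace
   in half, the circle is first rotated so that U spans the chosen half. *)
Require Import Defs.
From HB Require Import structures.
From mathcomp Require Import all_boot all_order all_algebra.
From mathcomp Require Import all_classical all_reals all_analysis.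
From mathcomp Require Import zify ring lra.

Set Implicit Arguments.
Unset Strict Implicit.
Unset Printing Implicit Defensive.

Import Order.TTheory GRing.Theory Num.Theory.
Import numFieldNormedType.Exports.

Local Open Scope classical_set_scope.
Local Open Scope ring_scope.

(** * Trigonometric identities and sampled waves *)

Lemma cosD2pin (R : realType) (x : R) (k : nat) : cos (x + 2 * pi * k%:R) = cos x.
Proof.
have -> : 2 * pi * k%:R = (pi *+ 2) *+ k :> R.
  by rewrite -[RHS]mulr_natr -[pi *+ 2]mulr_natl.
exact: periodicn (@cosD2pi R) k x.
Qed.

Lemma sinD2pin (R : realType) (x : R) (k : nat) : sin (x + 2 * pi * k%:R) = sin x.
Proof. by rewrite -!cosBpihalf addrAC cosD2pin. Qed.

Lemma cosDpin (R : realType) (x : R) (k : nat) :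
  cos (x + pi * k%:R) = (-1) ^+ k * cos x.
Proof.
elim: k x => [|k IHk] x; first by rewrite mulr0 addr0 mul1r.
by rewrite -natr1 mulrDr mulr1 addrA cosDpi IHk exprS mulN1r mulNr.
Qed.

Lemma cos_mul2 (R : realType) (x y : R) :
  cos x * cos y = 1 / 2 * (cos (x - y) + cos (x + y)).
Proof. by rewrite cosB cosD; lra. Qed.

(** Each term times [2 * sin (w / 2)] is a difference of two sines, so the sum telescopes. *)
Lemma sum_cos_progression (R : realType) (w psi : R) (n : nat) :
  (\sum_(t < n) cos (w * t%:R + psi)) * (2 * sin (w / 2)) =
  sin (w * n%:R + psi - w / 2) - sin (psi - w / 2).
Proof.
elim: n => [|n IHn]; first by rewrite big_ord0 mul0r mulr0 add0r subrr.
rewrite big_ord_recr /= mulrDl IHn -[n.+1%:R]natr1.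
have -> : w * (n%:R + 1) + psi - w / 2 = w * n%:R + psi + w / 2 by field.
by set x := w * n%:R + psi; rewrite (sinB x) (sinD x); ring.
Qed.

(** The phase [psi] treats cosines, sines ([psi = - (pi / 2)]) and their rotations uniformly. *)
Definition wave (R : realType) (n k : nat) (psi : R) (t : nat) : R :=
  cos (2 * pi * k%:R / n%:R * t%:R + psi).

Section Wave.
Variables (R : realType) (n : nat).
Hypothesis n_gt0 : (0 < n)%N.

Let n_neq0 : n%:R != 0 :> R.
Proof. by rewrite pnatr_eq0 -lt0n. Qed.

Lemma wave_periodic k (psi : R) t : wave n k psi (t + n) = wave n k psi t.
Proof.
rewrite /wave natrD mulrDr mulfVK // addrAC.
by rewrite -[_ * _ + _ + _]/(_ + 2 * pi * k%:R) cosD2pin.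
Qed.

Lemma wave_freqDn k q (psi : R) t : wave n (k + q * n) psi t = wave n k psi t.
Proof.
rewrite /wave -[RHS](cosD2pin _ (q * t)%N); congr cos.
by rewrite !natrD !natrM; field.
Qed.

Lemma sin_pi_frac_gt0 k : (0 < k < n)%N -> 0 < sin (pi * k%:R / n%:R) :> R.
Proof.
move=> /andP[k0 kn]; apply: sin_gt0_pi; rewrite divr_gt0 ?mulr_gt0 ?ltr0n ?pi_gt0 //=.
by rewrite ltr_pdivrMr ?ltr0n // ltr_pM2l ?pi_gt0 // ltr_nat.
Qed.

(** If [n] divides [k] the wave is constant. Otherwise [sin (w / 2)] is nonzero and the two
    telescoped ends differ by whole turns. *)
Lemma sum_wave k (psi : R) :
  \sum_(t < n) wave n k psi t = if (n %| k)%N then n%:R * cos psi else 0.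
Proof.
have [/dvdnP[q ->]|ndvd] := ifP.
  under eq_bigr => t _ do rewrite -[(q * n)%N]add0n wave_freqDn /wave mulr0 !mul0r add0r.
  by rewrite sumr_const card_ord mulr_natl.
rewrite (divn_eq k n) addnC; under eq_bigr => t _ do rewrite wave_freqDn.
have k1 : (0 < k %% n < n)%N by rewrite ltn_mod n_gt0 lt0n -/(dvdn n k) ndvd.
have /lt0r_neq0 s0 := sin_pi_frac_gt0 k1.
have := sum_cos_progression (2 * pi * (k %% n)%N%:R / n%:R) psi n.
set w := 2 * pi * _ / _.
have -> : w / 2 = pi * (k %% n)%N%:R / n%:R by rewrite /w; field.
have -> : w * n%:R + psi - pi * (k %% n)%:R / n%:R =
   psi - pi * (k %% n)%:R / n%:R + 2 * pi * (k %% n)%:R by rewrite /w; field.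
rewrite sinD2pin subrr => /eqP; rewrite !mulf_eq0 (negPf s0) pnatr_eq0 !orbF.
by move/eqP.
Qed.

(** The product formula gives waves of frequencies [k - l] and [k + l]; [l <= k] makes the natural
    subtraction exact. *)
Lemma inner_wave k l (psi chi : R) : (l <= k)%N ->
  \sum_(t < n) wave n k psi t * wave n l chi t =
  n%:R / 2 * ((if (n %| k - l)%N then cos (psi - chi) else 0)
              + (if (n %| k + l)%N then cos (psi + chi) else 0)).
Proof.
move=> lk.
rewrite (eq_bigr (fun t : 'I_n => 1 / 2 * (wave n (k - l) (psi - chi) t
    + wave n (k + l) (psi + chi) t))); last first.
  move=> t _; rewrite /wave cos_mul2 natrB // natrD; congr (_ * (cos _ + cos _)); by field.
rewrite -mulr_sumr big_split /= !sum_wave; do 2 case: ifP => _; by field.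
Qed.

(* Summing the second difference of a product telescopes, so second
   differences can be moved from one periodic factor to the other. *)
Lemma sum_second_difference (c f : nat -> R) (w : R) N :
  (forall t, f t.+2 + f t = w * f t.+1) ->
  c 1 * f 0 - c 0 * f 1 = c N.+1 * f N - c N * f N.+1 ->
  (w - 2) * (\sum_(t < N) c t.+1 * f t.+1) =
  \sum_(t < N) (c t.+2 + c t - 2 * c t.+1) * f t.+1.
Proof.
move=> fE bdry; apply/eqP; rewrite -subr_eq0 mulr_sumr -sumrB; apply/eqP.
transitivity (\sum_(0 <= t < N) ((c t.+1 * f t.+2 - c t.+2 * f t.+1)
   - (c t * f t.+1 - c t.+1 * f t))).
  rewrite big_mkord; apply: eq_bigr => t _.
  have -> : f t.+2 = w * f t.+1 - f t by rewrite -fE addrK.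
  by ring.
rewrite (telescope_sumr (fun t => c t * f t.+1 - c t.+1 * f t)) //.
by move/eqP: bdry; rewrite -subr_eq0 => /eqP <-; ring.
Qed.

Lemma wave_rec k (psi : R) t :
  wave n k psi t.+2 + wave n k psi t =
  2 * cos (2 * pi * k%:R / n%:R) * wave n k psi t.+1.
Proof.
rewrite /wave; set w := 2 * pi * _ / _; set x := w * t.+1%:R + psi.
have -> : w * t.+2%:R + psi = x + w by rewrite /x -[t.+2%:R]natr1; ring.
have -> : w * t%:R + psi = x - w by rewrite /x -[t.+1%:R]natr1; ring.
by rewrite cosD cosB; ring.
Qed.

End Wave.

(** * Squared cycle distance and closed form of the eigenvalues *)

Definition sqdist {R : realType} (n t : nat) : R :=
  Num.min (t%:R ^+ 2) ((n%:R - t%:R) ^+ 2).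

Lemma sqdist_l (R : realType) n t : (t.*2 <= n)%N -> sqdist n t = t%:R ^+ 2 :> R.
Proof.
move=> h; apply/min_idPl; rewrite ler_sqr ?nnegrE //.
  by rewrite lerBrDr -natrD ler_nat addnn.
by rewrite subr_ge0 ler_nat; lia.
Qed.

Lemma sqdist_r (R : realType) n t : (n <= t.*2)%N -> sqdist n t = (n%:R - t%:R) ^+ 2 :> R.
Proof.
move=> h; apply/min_idPr.
have [tn|tn] := leqP t n.
  by rewrite ler_sqr ?nnegrE ?subr_ge0 ?ler_nat // lerBlDr -natrD ler_nat addnn.
rewrite -sqrrN opprB ler_sqr ?nnegrE ?subr_ge0 ?ler_nat ?(ltnW tn) //.
by rewrite lerBlDr -natrD ler_nat leq_addr.
Qed.

(** The cosine is 1 for even [n]. At [k = 0] the inverse of zero is zero, so the value is 0, as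
    centering requires. *)
Definition eig {R : realType} (n k : nat) : R :=
  pi ^+ 2 / n%:R * (-1) ^+ k.+1 * cos (pi * k%:R / n%:R * (odd n)%:R)
  / sin (pi * k%:R / n%:R) ^+ 2.

Section Eig.
Variable R : realType.

Lemma sqdistC n t : (t <= n)%N -> sqdist n (n - t) = sqdist n t :> R.
Proof. by move=> tn; rewrite /sqdist natrB // subKr minC. Qed.

(** Away from the antipode the function is a monic quadratic. The kink there sits at one point,
    counted twice, for even [n], and is shared by the two middle points for odd [n]. *)
Lemma sqdist_second_difference n t : (0 < n)%N ->
  sqdist n t.+2 + sqdist n t - 2 * sqdist n t.+1 =
  2 - n%:R * ((t.+1 == n./2)%:R + (t.+1 == uphalf n)%:R) :> R.
Proof.
move=> n0; have nE := odd_double_half n; have uE := uphalf_half n.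
have [lt_h|ge_h] := ltnP t.+1 n./2.
  rewrite !sqdist_l; try lia.
  have [/negPf -> /negPf ->] : t.+1 != n./2 /\ t.+1 != uphalf n by lia.
  rewrite -[t.+2]addn2 -[t.+1]addn1 !natrD /=; ring.
have [ge_u|lt_u] := leqP (uphalf n) t.
  rewrite !sqdist_r; try lia.
  have [/negPf -> /negPf ->] : t.+1 != n./2 /\ t.+1 != uphalf n by lia.
  rewrite -[t.+2]addn2 -[t.+1]addn1 !natrD /=; ring.
have [th|th] := eqVneq t.+1 n./2.
  rewrite (@sqdist_r _ _ t.+2) ?sqdist_l; try lia.
  have -> : n = (t.*2 + odd n + 2)%N by lia.
  have -> : (t.+1 == uphalf (t.*2 + odd n + 2)) = ~~ odd n by lia.
  rewrite -addnn -[t.+2]addn2 -[t.+1]addn1 !natrD; case: (odd n) => /=; ring.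
have on : odd n by lia.
rewrite (@sqdist_l _ _ t) ?sqdist_r; try lia.
have -> : (t.+1 == uphalf n) by lia.
have -> : n = (t.*2 + 1)%N by lia.
by rewrite -addnn -[t.+2]addn2 -[t.+1]addn1 !natrD /=; ring.
Qed.

Lemma sum_shift1 (V : zmodType) (n : nat) (F : nat -> V) : F n = F 0 ->
  \sum_(t < n) F t.+1 = \sum_(t < n) F t.
Proof.
move=> Fn; case: n Fn => [|n] Fn; first by rewrite !big_ord0.
by rewrite big_ord_recr big_ord_recl /= Fn addrC.
Qed.

Lemma sum_shift_periodic (V : zmodType) (n r : nat) (F : nat -> V) :
  (forall t, F (t + n)%N = F t) -> \sum_(t < n) F (t + r)%N = \sum_(t < n) F t.
Proof.
move=> Fn; elim: r => [|r <-]; first by under eq_bigr do rewrite addn0.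
under eq_bigr do rewrite addnS -addSn.
by rewrite (@sum_shift1 V n (fun t => F (t + r)%N)) // addnC Fn.
Qed.

(** Two summations by parts move the second difference onto [sqdist]; its constant part sums to zero
    against the wave, and only the antipodal terms survive. *)
Lemma sum_sqdist_wave n k (psi : R) : (0 < k < n)%N ->
  2 * pi ^+ 2 / n%:R ^+ 2 * (\sum_(t < n) sqdist n t * wave n k psi t) =
  - eig n k * cos psi.
Proof.
move=> kn; have n0 : (0 < n)%N by lia.
have nn0 : n%:R != 0 :> R by rewrite pnatr_eq0 -lt0n.
have c0 : sqdist n 0 = 0 :> R by rewrite sqdist_l // expr0n.
have cn : sqdist n n = 0 :> R by rewrite -sqdistC // subnn.
rewrite -(@sum_shift1 _ n (fun t => sqdist n t * wave n k psi t)); last first.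
  by rewrite c0 cn !mul0r.
(* The boundary terms reduce to the wave at 0 and at [n], which agree by periodicity. *)
have := sum_second_difference (c := sqdist n) (N := n) (wave_rec n k psi).
rewrite c0 cn !mul0r !subr0.
have -> : sqdist n 1 = 1 :> R by rewrite sqdist_l ?expr1n //; lia.
have -> : sqdist n n.+1 = 1 :> R.
  by rewrite sqdist_r; [rewrite -natr1 opprD addrA subrr add0r sqrrN expr1n|lia].
rewrite -{2}[n in wave n k psi n]add0n wave_periodic // => /(_ erefl).
under [in RHS]eq_bigr do rewrite sqdist_second_difference // mulrBl mulrDr mulrDl.
rewrite sumrB big_split /= -mulr_sumr.
have -> : \sum_(t < n) wave n k psi t.+1 = 0.
  rewrite (sum_shift1 (F := wave n k psi)); last first.
    by rewrite -[n in wave n k psi n]add0n wave_periodic.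
  by rewrite sum_wave // gtnNdvd //; lia.
have pick h : (0 < h <= n)%N ->
    \sum_(t < n) n%:R * (t.+1 == h)%:R * wave n k psi t.+1 = n%:R * wave n k psi h.
  move=> hn; have h1 : (h.-1 < n)%N by lia.
  rewrite (bigD1 (Ordinal h1)) //= big1 => [|t].
    by rewrite prednK ?eqxx ?mulr1 ?addr0 //; lia.
  rewrite -val_eqE /= => th; have -> : (t.+1 == h) = false by lia.
  by rewrite mulr0 mul0r.
rewrite !pick; [|lia|lia].
rewrite mulr0 sub0r -mulrDr.
(* The phases at the two middle points are symmetric about [psi + pi * k], at distance
   [w * odd n]. *)
have -> : wave n k psi n./2 + wave n k psi (uphalf n) =
    2 * (-1) ^+ k * cos (pi * k%:R / n%:R * (odd n)%:R) * cos psi.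
  rewrite /wave uphalf_half natrD.
  set w := pi * k%:R / n%:R.
  have wn : w * n%:R = pi * k%:R by rewrite /w divfK.
  have nE : n%:R = (odd n)%:R + 2 * (n./2)%:R :> R.
    by rewrite -[LHS](congr1 (fun i => i%:R) (odd_double_half n)) natrD -mul2n natrM.
  have -> : 2 * pi * k%:R / n%:R * n./2%:R + psi = psi + pi * k%:R - w * (odd n)%:R.
    by rewrite -wn {2}nE /w; field.
  have -> : 2 * pi * k%:R / n%:R * ((odd n)%:R + n./2%:R) + psi
      = psi + pi * k%:R + w * (odd n)%:R.
    by rewrite -wn {2}nE /w; field.
  by set y := psi + _; rewrite (cosB y) (cosD y) /y cosDpin; ring.
have sE : 2 * cos (2 * pi * k%:R / n%:R) - 2 = - 4 * sin (pi * k%:R / n%:R) ^+ 2 :> R.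
  have -> : 2 * pi * k%:R / n%:R = (pi * k%:R / n%:R) *+ 2 :> R.
    by rewrite -[RHS]mulr_natl; field.
  by rewrite cos_mulr2n cos2sin2; ring.
rewrite sE /eig; have := sin_pi_frac_gt0 R n0 kn.
rewrite [(-1) ^+ k.+1]exprS; set e : R := (-1) ^+ k.
set s := sin _; set c := cos _; set S := \sum_(t < n) _ => /lt0r_neq0 s0 E.
have -> : S = n%:R * (e * c * cos psi) / (2 * s ^+ 2).
  apply: (@mulfI _ (- 4 * s ^+ 2)); first by rewrite mulf_neq0 // sqrf_eq0.
  by rewrite E; field.
by field; rewrite s0 nn0.
Qed.
End Eig.

(** * Arc distances and the action of the centered matrix on waves *)

Lemma arc_distE (R : realType) (s t : R) (k : int) :
  `|s - t - (2 * pi) *~ k| <= pi -> arc_dist s t = `|s - t - (2 * pi) *~ k|.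
Proof.
set z := s - t - _ => z_pi; apply/eqP; rewrite eq_le; apply/andP; split.
  apply: ge_inf; last by exists k.
  by exists 0 => _ [l _ <-]; exact: normr_ge0.
apply: lb_le_inf => [|_ [l _ <-]]; first by exists `|z|, k.
(* Any other lift differs from [z] by at least [2 * pi], hence has absolute value at least [pi]. *)
have [->//|lk] := eqVneq l k.
have -> : s - t - (2 * pi) *~ l = z - (2 * pi) *~ (l - k) by rewrite /z mulrzBr; ring.
set m := l - k; have m_ge1 : 1 <= `|m%:~R| :> R.
  by rewrite -intr_norm ler1z -gtz0_ge1 normr_gt0 subr_eq0.
have := ler_normB z (z - (2 * pi) *~ m); rewrite subKr -[(2 * pi) *~ m]mulrzr normrM.
rewrite ger0_norm ?mulr_ge0 ?pi_ge0 //.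
have := ler_wpM2l (pi_ge0 R) m_ge1; move: z_pi; lra.
Qed.

Section Spectrum.
Variables (R : realType) (n : nat).

Lemma circle_dist_mx_sqr (i j : 'I_n) :
  circle_dist_mx R n i j ^+ 2 =
  (2 * pi / n%:R) ^+ 2 * sqdist n ((j + (n - i)) %% n).
Proof.
have n0 : n%:R != 0 :> R by rewrite pnatr_eq0; case: i => i /= ? ; lia.
have [ln_i ln_j] := (ltn_ord i, ltn_ord j).
rewrite /circle_dist_mx mxE.
(* Here [d] is the signed number of steps after removing [k] turns; it must be at most half the
   circle. *)
have key (k : int) (d : R) : i%:R - j%:R - k%:~R * n%:R = d -> `|d| * 2 <= n%:R ->
    arc_dist (circle_pt R i) (circle_pt R j) ^+ 2 = (2 * pi / n%:R) ^+ 2 * d ^+ 2.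
  move=> dE d_n.
  have zE : circle_pt R i - circle_pt R j - (2 * pi) *~ k = 2 * pi / n%:R * d.
    by rewrite /circle_pt -dE -mulrzr; field.
  rewrite (@arc_distE _ _ _ k) zE; first by rewrite real_normK ?num_real // exprMn.
  rewrite normrM ger0_norm ?divr_ge0 ?mulr_ge0 ?pi_ge0 //.
  rewrite mulrAC ler_pdivrMr ?ltr0n; last by lia.
  by have := ler_wpM2l (pi_ge0 R) d_n; lra.
have [ij|/ltnW ji] := leqP i j.
  have -> : ((j + (n - i)) %% n = j - i)%N.
    by rewrite addnBA 1?ltnW // addnC -addnBA // modnDl modn_small //; lia.
  have [le_n|gt_n] := leqP (j - i).*2 n.
    rewrite sqdist_l // (@key 0 (- (j - i)%:R)) ?sqrrN //.
      by rewrite natrB //; ring.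
    by rewrite normrN normr_nat -natrM ler_nat muln2.
  rewrite sqdist_r 1?ltnW // (@key (-1) (n%:R - (j - i)%:R)) //.
    by rewrite natrB //; ring.
  by rewrite -natrB ?normr_nat -?natrM ?ler_nat ?muln2; lia.
have [ij0|ij] := eqVneq (i : nat) j.
  rewrite ij0 addnBA 1?ltnW // addnC addnK modnn sqdist_l // (@key 0 0) //.
    by rewrite ij0; ring.
  by rewrite normr0 mul0r.
have -> : ((j + (n - i)) %% n = n - (i - j))%N.
  by rewrite modn_small; lia.
rewrite sqdistC; last by lia.
have [le_n|gt_n] := leqP (i - j).*2 n.
  rewrite sqdist_l // (@key 0 (i - j)%:R) //.
    by rewrite natrB //; ring.
  by rewrite normr_nat -natrM ler_nat muln2.
rewrite sqdist_r 1?ltnW // -[(n%:R - _) ^+ 2]sqrrN opprB (@key 1 ((i - j)%:R - n%:R)) //.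
  by rewrite natrB //; ring.
by rewrite distrC -natrB ?normr_nat -?natrM ?ler_nat ?muln2; lia.
Qed.

(* The row sums of a circulant matrix are all equal, so double centering only
   changes its eigenvalue on the constant vectors, which becomes 0. *)
Lemma mds_B_wave (k : nat) (psi : R) (i : 'I_n) : (k < n)%N ->
  \sum_j mds_B (circle_dist_mx R n) i j * wave n k psi j =
  eig n k * wave n k psi i.
Proof.
move=> kn; have n_gt0 : (0 < n)%N by lia.
have n0 : n%:R != 0 :> R by rewrite pnatr_eq0 -lt0n.
set a := fun t => - (1 / 2) * ((2 * pi / n%:R) ^+ 2 * sqdist n t) : R.
have AE r s : mds_A (circle_dist_mx R n) r s = a ((s + (n - r)) %% n)%N.
  by rewrite mxE circle_dist_mx_sqr.
(* Reindexing by [t = s - r] modulo [n] turns row [r] into row 0 and moves the shift into the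
   phase. *)
have conv (r : 'I_n) (l : nat) (chi : R) :
    \sum_s mds_A (circle_dist_mx R n) r s * wave n l chi s =
    \sum_(t < n) a t * wave n l (2 * pi * l%:R / n%:R * r%:R + chi) t.
  under eq_bigr do rewrite AE.
  set chi' := _ + chi; set f := fun t => a (t %% n)%N * wave n l chi' t.
  transitivity (\sum_(s < n) f (s + (n - r))%N).
    apply: eq_bigr => s _; congr (_ * _); rewrite -(wave_periodic n_gt0) /wave /chi'.
    congr cos; rewrite !natrD natrB 1?ltnW //; ring.
  rewrite sum_shift_periodic => [|t]; last by rewrite /f modnDr wave_periodic.
  by apply: eq_bigr => t _; rewrite /f modn_small.
set S := \sum_(t < n) a t.
(* Frequency 0 with phase 0 is the constant wave 1, so [conv] yields the row sums. *)
have rowS r : \sum_s mds_A (circle_dist_mx R n) r s = S.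
  have := conv r 0 0; rewrite /wave mulr0 !mul0r !addr0.
  under eq_bigr do rewrite !(mulr0, mul0r) addr0 cos0 mulr1.
  by move=> ->; apply: eq_bigr => t _; rewrite !(mulr0, mul0r) addr0 cos0 mulr1.
(* The indices [s - r] and [r - s] modulo [n] are swapped by [sqdistC]. *)
have colS s : \sum_r mds_A (circle_dist_mx R n) r s = S.
  rewrite -(rowS s); apply: eq_bigr => r _; rewrite !AE /a; congr (_ * (_ * _)).
  have [lr ls] := (ltn_ord r, ltn_ord s).
  have [->|] := eqVneq r s; [by []|rewrite -val_eqE /= => rs].
  rewrite -[LHS]sqdistC; last by rewrite ltnW // ltn_mod.
  congr sqdist; have [|] := leqP r s => h.
    rewrite (modn_small (m := (r + (n - s))%N)); last by lia.
    have -> : (s + (n - r))%N = (n + (s - r))%N by lia.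
    by rewrite modnDl modn_small; lia.
  rewrite (modn_small (m := (s + (n - r))%N)); last by lia.
  have -> : (r + (n - s))%N = (n + (r - s))%N by lia.
  by rewrite modnDl modn_small; lia.
have BE r s : mds_B (circle_dist_mx R n) r s =
    mds_A (circle_dist_mx R n) r s - S / n%:R.
  rewrite mxE rowS colS; under eq_bigr do rewrite rowS.
  by rewrite sumr_const card_ord -mulr_natr; field.
under eq_bigr do rewrite BE mulrBl.
rewrite sumrB conv -mulr_sumr sum_wave //.
(* On constants centering gives 0, matching [eig n 0]; for other [k] the wave has sum zero and
   centering is invisible. *)
have [->|k0] := posnP k.
  rewrite /eig /wave dvdn0 !(mulr0, mul0r) !add0r sin0 expr0n invr0 !(mulr0, mul0r).
  under eq_bigr do rewrite !(mulr0, mul0r) add0r.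
  by rewrite -mulr_suml -/S; field.
rewrite gtnNdvd // mulr0 subr0.
set chi := _ + psi.
rewrite (eq_bigr (fun t : 'I_n => - (2 * pi ^+ 2 / n%:R ^+ 2)
    * (sqdist n t * wave n k chi t))); last by move=> t _; rewrite /a; field.
by rewrite -mulr_sumr mulNr sum_sqdist_wave ?k0 // mulNr opprK.
Qed.

End Spectrum.

(** * Signs and order of the eigenvalues *)

Section EigOrder.
Variable R : realType.
Implicit Types n j k : nat.

(** The angle becomes [pi - x], which fixes the sine. For odd [n] the cosine and the power of -1
    both change sign. *)
Lemma eig_sym n k : (k <= n)%N -> eig n (n - k) = eig n k :> R.
Proof.
move=> kn; have [->|n_gt0] := posnP n; first by rewrite /eig !(invr0, mulr0, mul0r).
have n0 : n%:R != 0 :> R by rewrite pnatr_eq0 -lt0n.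
rewrite /eig natrB //; set x := pi * k%:R / n%:R.
have -> : pi * (n%:R - k%:R) / n%:R = pi - x by rewrite /x; field.
have -> : sin (pi - x) = sin x by rewrite sinB sinpi cospi; ring.
have -> : (-1) ^+ (n - k).+1 = (-1) ^+ n * (-1) ^+ k.+1 :> R.
  by rewrite !exprS -signr_odd oddB // signr_addb !signr_odd; ring.
have <- : (-1) ^+ n * cos ((pi - x) * (odd n)%:R) = cos (x * (odd n)%:R).
  rewrite -signr_odd; case: odd; last by rewrite !mulr0 mul1r.
  by rewrite expr1 !mulr1 cosB sinpi cospi; ring.
by ring.
Qed.

Lemma pi_frac_itv n k : (k.*2 <= n)%N -> (0 < n)%N ->
  0 <= (pi * k%:R / n%:R : R) <= pi / 2.
Proof.
move=> kn n0; rewrite divr_ge0 ?mulr_ge0 ?pi_ge0 //= ler_pdivrMr ?ltr0n //.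
rewrite -mulrA ler_wpM2l ?pi_ge0 // mulrC ler_pdivlMr // -natrM ler_nat; lia.
Qed.

Lemma cos_eig_ge0 n k : (k.*2 <= n)%N ->
  0 <= cos (pi * k%:R / n%:R * (odd n)%:R) :> R.
Proof.
move=> kn; have [->|n0] := posnP n; first by rewrite mulr0 cos0.
have /andP[x0 x1] := pi_frac_itv kn n0; have p0 := pi_ge0 R.
case: odd; rewrite ?mulr1 ?mulr0 ?cos0 //.
by apply: cos_ge0_pihalf; rewrite x1 andbT; lra.
Qed.

Lemma eig_le0 n k : ~~ odd k -> (k.*2 <= n)%N -> eig n k <= 0 :> R.
Proof.
move=> ek kn; rewrite /eig -signr_odd /= ek expr1 mulrN1 !mulNr oppr_le0.
by rewrite divr_ge0 ?sqr_ge0 // mulr_ge0 ?cos_eig_ge0 // divr_ge0 ?sqr_ge0.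
Qed.

Lemma eigE n k : odd k ->
  eig n k = pi ^+ 2 / n%:R * (cos (pi * k%:R / n%:R * (odd n)%:R)
    / sin (pi * k%:R / n%:R) ^+ 2) :> R.
Proof. by move=> ok; rewrite /eig -signr_odd /= ok expr0 mulr1 mulrA. Qed.

Lemma eig_gt0 n k : odd k -> (k.*2 <= n)%N -> 0 < eig n k :> R.
Proof.
move=> ok kn; have n0 : (0 < n)%N by case: k ok kn => // k _; lia.
have s0 : 0 < sin (pi * k%:R / n%:R) :> R.
  by apply: sin_pi_frac_gt0; case: k ok kn => // k; lia.
have /andP[x0 x1] := pi_frac_itv kn n0; have p0 := pi_gt0 R.
rewrite eigE // mulr_gt0 ?divr_gt0 ?exprn_gt0 ?ltr0n //.
case on : (odd n); rewrite ?mulr1 ?mulr0 ?cos0 //.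
apply: cos_gt0_pihalf; apply/andP; split; first lra.
rewrite ltr_pdivrMr ?ltr0n // -mulrA ltr_pM2l // mulrC ltr_pdivlMr // -natrM ltr_nat.
lia.
Qed.

(** On the interval from 0 to [pi / 2] the numerator does not increase and the squared sine
    increases strictly. *)
Lemma eig_lt n j k : odd j -> odd k -> (j < k)%N -> (k.*2 <= n)%N ->
  eig n k < eig n j :> R.
Proof.
move=> oj ok jk kn; have n0 : (0 < n)%N by lia.
have jn : (j.*2 <= n)%N by lia.
have kn' : (0 < k < n)%N by lia.
have jn' : (0 < j < n)%N by case: j oj jk jn => // j; lia.
have n0R : 0 < n%:R^-1 :> R by rewrite invr_gt0 ltr0n.
have /andP[xj0 xj1] := pi_frac_itv jn n0; have /andP[xk0 xk1] := pi_frac_itv kn n0.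
have p0 := pi_gt0 R.
have xjk : pi * j%:R / n%:R < pi * k%:R / n%:R :> R.
  by rewrite ltr_pM2r // ltr_pM2l // ltr_nat.
have sj := sin_pi_frac_gt0 R n0 jn'; have sk := sin_pi_frac_gt0 R n0 kn'.
have C0 : 0 < pi ^+ 2 / n%:R :> R by rewrite divr_gt0 ?exprn_gt0 ?ltr0n.
have cj : 0 < cos (pi * j%:R / n%:R * (odd n)%:R) :> R.
  have := eig_gt0 oj jn; rewrite eigE // (pmulr_rgt0 _ C0).
  by rewrite pmulr_lgt0 // invr_gt0 exprn_gt0.
rewrite !eigE // (ltr_pM2l C0).
rewrite ltr_pdivrMr ?exprn_gt0 // [ltRHS]mulrAC ltr_pdivlMr ?exprn_gt0 //.
(* After cross-multiplication, the numerator is compared first, then the squared sine. *)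
apply: (@le_lt_trans _ _ (cos (pi * j%:R / n%:R * (odd n)%:R) * sin (pi * j%:R / n%:R) ^+ 2)).
  rewrite ler_wpM2r ?sqr_ge0 //; case: odd; rewrite ?mulr1 ?mulr0 //.
  by rewrite ltW // ltr_cos ?in_itv /=; [|lra..].
rewrite ltr_pM2l // ltr_sqr ?nnegrE ?ltW // ltr_sin //; rewrite in_itv /=; lra.
Qed.

(** * Limits of the coefficients of the curve *)

Lemma cvg_sin_over : (sin x / x : R) @[x --> (0 : R)^'] --> (1 : R).
Proof.
have [dv de] := @is_derive_sin R 0; rewrite -(cos0 R) -de.
have /= := dv; rewrite /derivable /= => h.
apply: cvg_trans h; apply: near_eq_cvg; near=> x.
by rewrite /= sin0 subr0 addr0 [x *: _]mulr1 -[RHS]mulrC.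
Unshelve. all: by end_near. Qed.
End EigOrder.

(* The eigenvectors [wave n j psi] have squared norm n / 2, except for the
   alternating vector at the frequency j = n / 2, whose squared norm is n. *)
Definition wave_scale {R : realType} (n j : nat) : R :=
  Num.sqrt ((if j.*2 == n then 1 else 2) / n%:R).

(** MDS scales a unit eigenvector by the square root of its eigenvalue; the second factor makes the
    sampled wave a unit vector. *)
Definition curve_coef {R : realType} (j n : nat) : R :=
  Num.sqrt (eig n j) * wave_scale n j.

(** With [x = pi * j / n], the squared coefficient is eventually [2 / j ^ 2] times a cosine tending
    to 1, divided by the square of [sin x / x]. *)
Lemma cvg_curve_coef (R : realType) (j : nat) : odd j ->
  (fun n => curve_coef j n : R) @ \oo --> (Num.sqrt 2 / j%:R : R).
Proof.
move=> oj; have j0 : (0 < j)%N by case: j oj.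
have jn0 : j%:R != 0 :> R by rewrite pnatr_eq0 -lt0n.
have p0 : pi != 0 :> R by rewrite gt_eqF ?pi_gt0.
(* Shifting the index keeps the denominators nonzero. *)
rewrite -cvg_shiftS /=.
pose x (n : nat) : R := pi * j%:R / n.+1%:R.
have x_neq0 n : x n != 0 by apply: mulf_neq0; [exact: mulf_neq0|rewrite invr_eq0 pnatr_eq0].
have x_cvg : x @ \oo --> 0.
  have := cvgM (cvg_cst (pi * j%:R : R)) (@cvg_harmonic R); rewrite mulr0.
  exact.
have sin_cvg : (fun n => sin (x n) / x n) @ \oo --> (1 : R).
  by have /cvgr_dnbhsP := @cvg_sin_over R; apply; split.
have cos_cvg : (fun n => cos (x n * (odd n.+1)%:R)) @ \oo --> (1 : R).
  suff : (fun n => cos (x n * (odd n.+1)%:R)) @ \oo --> (cos 0 : R) by rewrite cos0.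
  apply: continuous_cvg; first exact: continuous_cos.
  apply/norm_cvg0P; apply: (@squeeze_cvgr _ _ _ _ (fun=> 0) (fun n => `|x n|)).
  - near=> n; rewrite normr_ge0 normrM ler_piMr ?normr_ge0 //.
    by rewrite normr_nat lern1 leq_b1.
  - exact: cvg_cst.
  - by have := cvg_norm x_cvg; rewrite normr0; exact.
have : (fun n => Num.sqrt (2 / j%:R ^+ 2 * (cos (x n * (odd n.+1)%:R)
    / (sin (x n) / x n) ^+ 2))) @ \oo --> Num.sqrt (2 / j%:R ^+ 2 : R).
  apply: continuous_cvg; first exact: sqrt_continuous.
  have sin2_cvg : (fun n => (sin (x n) / x n) ^+ 2) @ \oo --> (1 * 1 : R).
    exact: cvgM.
  rewrite mulr1 in sin2_cvg.
  suff : (fun n => 2 / j%:R ^+ 2 * (cos (x n * (odd n.+1)%:R)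
      / (sin (x n) / x n) ^+ 2)) @ \oo --> (2 / j%:R ^+ 2 * (1 * 1^-1) : R).
    by rewrite invr1 !mulr1.
  by apply: cvgM; [exact: cvg_cst|apply: cvgM => //; apply: cvgV].
rewrite sqrtrM // sqrtrV ?exprn_ge0 // sqrtr_sqr normr_nat; apply: cvg_trans.
apply: near_eq_cvg; near=> n.
(* Eventually [j] is below half the number of points, so the eigenvalue is positive and the scale
   takes its generic value. *)
have nj : (j.*2 < n.+1)%N by near: n; exists j.*2 => // i /=; lia.
rewrite /curve_coef /wave_scale ltn_eqF // -sqrtrM; last by rewrite ltW ?eig_gt0 //; lia.
have s0 : sin (x n) != 0.
  by rewrite gt_eqF // sin_pi_frac_gt0 //; lia.
have nn0 : n.+1%:R != 0 :> R by rewrite pnatr_eq0.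
congr Num.sqrt; rewrite eigE // -/(x n).
have -> : pi = x n * n.+1%:R / j%:R by rewrite /x divfK // mulfK.
move: (x n) (n.+1%:R) (cos _) (x_neq0 n) s0 nn0 => y N c y0 s0 N0.
by field; rewrite s0 N0 y0 jn0.
Unshelve. all: by end_near. Qed.

(** * The spectrum with multiplicities *)

Lemma char_poly_orthogonal (R : comUnitRingType) (n : nat) (G : 'M[R]_n) (L : 'rV[R]_n) :
  G^T *m G = 1%:M ->
  char_poly (G *m diag_mx L *m G^T) = \prod_(i < n) ('X - (L 0 i)%:P).
Proof.
move=> GTG; have GGT := mulmx1C GTG.
have -> : char_poly (G *m diag_mx L *m G^T) = char_poly (diag_mx L).
  rewrite /char_poly; set P := map_mx polyC G.
  have PPT : P *m map_mx polyC G^T = 1%:M by rewrite -map_mxM GGT map_mx1.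
  have -> : char_poly_mx (G *m diag_mx L *m G^T) =
      P *m char_poly_mx (diag_mx L) *m map_mx polyC G^T.
    rewrite /char_poly_mx mulmxBr mulmxBl mul_mx_scalar -scalemxAl PPT.
    by rewrite scalemx1 !map_mxM.
  by rewrite !det_mulmx mulrAC -det_mulmx PPT det1 mul1r.
rewrite char_poly_trig ?diag_mx_is_trig //.
by apply: eq_bigr => i _; rewrite mxE eqxx mulr1n.
Qed.

(* Up to a factor sqrt 2, [wave n k (- pi / 4)] is the Hartley function
   cos + sin at frequency k: unlike the cosines and sines, these n real vectors
   need no case distinction on the parity of n. *)
Lemma char_poly_mds_B_circle (R : realType) (n : nat) :
  char_poly (mds_B (circle_dist_mx R n)) = \prod_(k < n) ('X - (eig n k)%:P).
Proof.
pose psi : R := - (pi / 4).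
pose H : 'M[R]_n := \matrix_(t, k) (Num.sqrt (2 / n%:R) * wave n k psi t).
have HTH : H^T *m H = 1%:M.
  apply/matrixP => k l; rewrite !mxE.
  have n_gt0 : (0 < n)%N by case: k => k /= ?; lia.
  have n0 : n%:R != 0 :> R by rewrite pnatr_eq0 -lt0n.
  wlog lk : k l / (l <= k)%N => [hw|].
    have [lk|/ltnW kl] := leqP l k; first exact: hw.
    rewrite eq_sym -(hw _ _ kl); apply: eq_bigr => t _; rewrite mulrC; congr (_ * _).
      by rewrite !mxE.
    by rewrite !mxE.
  rewrite (eq_bigr (fun t : 'I_n => 2 / n%:R * (wave n k psi t * wave n l psi t))).
    rewrite -mulr_sumr inner_wave // subrr cos0.
    (* This is why the phase is [- (pi / 4)]: the term for [n] dividing [k + l] gets the factor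
       [cos (pi / 2) = 0]. *)
    have -> : psi + psi = - (pi / 2) by rewrite /psi; field.
    rewrite cosN cos_pihalf if_same addr0 -val_eqE /=.
    have -> : (n %| k - l)%N = (k == l :> nat).
      have [->|kl] := eqVneq (k : nat) l; first by rewrite subnn dvdn0.
      by rewrite gtnNdvd //; have := ltn_ord k; lia.
    by case: eqP => _ /=; rewrite ?mulr0 //; field.
  move=> t _; rewrite !mxE mulrACA -expr2 sqr_sqrtr // divr_ge0 //.
have BH : mds_B (circle_dist_mx R n) *m H = H *m diag_mx (\row_k eig n k).
  apply/matrixP => i k; rewrite mul_mx_diag !mxE -mulrA [_ * eig n k]mulrC.
  rewrite -mds_B_wave // mulr_sumr; apply: eq_bigr => t _; rewrite [H _ _]mxE; ring.
rewrite -[mds_B _]mulmx1 -(mulmx1C HTH) mulmxA BH char_poly_orthogonal //.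
by apply: eq_bigr => k _; rewrite mxE.
Qed.

(* Positions are counted from 0: positions 0, 1, 2, 3, ... carry the eigenvalues
   of frequencies 1, 1, 3, 3, ... *)
Definition freq (i : nat) : nat := i./2.*2.+1.

(** The number of positive eigenvalues: [n / 2] odd frequencies for even [n], and twice the number
    of odd frequencies up to [n / 2] for odd [n]. *)
Definition npos (n : nat) : nat := n./2 + (odd n && odd n./2).

Lemma odd_freq i : odd (freq i).
Proof. by rewrite /freq /= odd_double. Qed.

Lemma freq_le n i : (i < npos n)%N -> ((freq i).*2 <= n)%N.
Proof. rewrite /freq /npos; lia. Qed.

Lemma freq_lt n i : odd i -> (i < npos n)%N -> ((freq i).*2 < n)%N.
Proof. rewrite /freq /npos; lia. Qed.

Lemma npos_le n : (npos n <= n)%N.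
Proof. rewrite /npos; lia. Qed.

Section Order.
Variables (R : realType) (n : nat).

Lemma perm_eig : exists2 rest : seq R, all (<= 0) rest &
  perm_eq [seq eig n k | k <- iota 0 n]
          ([seq eig n (freq i) | i <- iota 0 (npos n)] ++ rest).
Proof.
(* Even positions take the frequency [freq i = i + 1], odd positions its mirror image
   [n - freq i = n - i]. *)
pose e i := if odd i then (n - i)%N else i.+1.
pose E := [seq e i | i <- iota 0 (npos n)].
have e_lt i : (i < npos n)%N -> (e i < n)%N.
  by rewrite /e /npos; case: ifP; lia.
have uE : uniq E.
  rewrite map_inj_in_uniq ?iota_uniq // => i j; rewrite !mem_iota /e /npos /=.
  by do 2 case: ifP; lia.
pose rest := [seq k <- iota 0 n | k \notin E].
exists [seq eig n k | k <- rest].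
  apply/allP => x /mapP[k + ->]; rewrite mem_filter mem_iota /= => /andP[kE kn].
  have [k_le|k_gt] := leqP k.*2 n.
    apply: eig_le0 => //; apply: contra kE => ok; apply/mapP; exists k.-1.
      by rewrite mem_iota /npos; lia.
    by rewrite /e; case: ifP; lia.
  rewrite -eig_sym 1?ltnW //; apply: eig_le0; last by lia.
  apply: contra kE => ok; apply/mapP; exists (n - k)%N.
    by rewrite mem_iota /npos; lia.
  by rewrite /e ok; lia.
have -> : [seq eig n (freq i) | i <- iota 0 (npos n)] = [seq eig n k | k <- E] :> seq R.
  rewrite -map_comp; apply/eq_in_map => i; rewrite mem_iota /= => i_lt.
  rewrite /e; case: ifP => oi; last by congr eig; rewrite /freq; lia.
  rewrite eig_sym; first by congr eig; rewrite /freq; lia.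
  by have := npos_le n; lia.
rewrite -map_cat; apply: perm_map.
rewrite -(perm_filterC (mem E) (iota 0 n)) perm_cat2r.
apply: uniq_perm => //; first by rewrite filter_uniq ?iota_uniq.
move=> k; rewrite mem_filter /= mem_iota /=; case kE: (k \in E) => //=.
by have /mapP[i + ->] := kE; rewrite mem_iota => /e_lt ->.
Qed.

Lemma at_least_pos_eigenvalues_circle m :
  at_least_pos_eigenvalues m (mds_B (circle_dist_mx R n)) -> (m <= npos n)%N.
Proof.
move=> [s [<- s_gt0]]; rewrite char_poly_mds_B_circle.
rewrite -(big_mkord xpredT (fun k => 'X - (eig n k)%:P)) /index_iota subn0.
rewrite -(big_map (fun k => eig n k) xpredT (fun x => 'X - x%:P)).
(* A monic divisor of a product of linear factors is the product of a subfamily, so counting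
   positive roots bounds [m]. *)
move=> /dvdp_prod_XsubC[b]; rewrite eqp_monic ?monic_prod_XsubC // => /eqP/prod_XsubC_eq.
move=> /permP /(_ (> 0)) eq_count.
move: s_gt0; rewrite all_count => /eqP <-; rewrite eq_count.
apply: leq_trans (leq_count_subseq _ (mask_subseq _ _)) _.
have [rest rest_le0 /permP ->] := perm_eig.
have count0 : count (> 0) rest = 0%N.
  apply/eqP; rewrite -leqn0 leqNgt -has_count.
  by apply/hasPn => x /(allP rest_le0) /=; rewrite leNgt.
rewrite count_cat count0 addn0.
by apply: leq_trans (count_size _ _) _; rewrite size_map size_iota.
Qed.

(** Both lists of eigenvalues are roots of the same characteristic polynomial, hence permutations of
    each other; both decrease, so they are equal. *)
Lemma circle_spectrum (G : 'M[R]_n) (L : 'rV[R]_n) :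
  sorted_eigendecomposition (mds_B (circle_dist_mx R n)) G L ->
  forall i : 'I_n, if (i < npos n)%N then L 0 i = eig n (freq i) else L 0 i <= 0.
Proof.
move=> [GTG BE L_sorted].
have [rest rest_le0 perm_rest] := perm_eig.
have ge_trans : transitive (>=%O : rel R) by move=> x y z xy yz; exact: le_trans yz xy.
have LE : [seq L 0 i | i <- enum 'I_n] =
    [seq eig n (freq i) | i <- iota 0 (npos n)] ++ sort >=%O rest.
  apply: (@sorted_eq _ >=%O) => //.
  - exact: ge_anti.
  - rewrite sorted_pairwise // pairwise_map.
    have : pairwise (relpre val ltn) (enum 'I_n).
      rewrite -pairwise_map val_enum_ord -sorted_pairwise ?iota_ltn_sorted //.
      exact: ltn_trans.
    by apply: sub_pairwise => i j /= ij; apply: L_sorted; exact: ltnW.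
  - rewrite sorted_pairwise // pairwise_cat; apply/and3P; split.
    + apply/allrelP => x y /mapP[i +->]; rewrite mem_iota mem_sort => /= i_lt.
      move=> /(allP rest_le0) y0.
      by apply: (le_trans y0); rewrite ltW ?eig_gt0 ?odd_freq ?freq_le.
    + rewrite pairwise_map -sorted_pairwise; last first.
        by move=> x y z /= xy yz; exact: le_trans yz xy.
      apply: (@sub_in_sorted _ (mem (iota 0 (npos n))) ltn) (iota_ltn_sorted _ _).
        move=> i j; rewrite /= ?inE !mem_iota /= => i_lt j_lt ij.
        have [eq_f|lt_f] := leqP (freq j) (freq i).
          have ij' : (i < j)%N := ij; have -> // : freq i = freq j.
          by rewrite /freq in eq_f *; lia.
        by rewrite ltW // eig_lt ?odd_freq ?freq_le.
      exact/allP.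
    + by rewrite -sorted_pairwise // sort_sorted // => x y; exact: le_total.
  apply: (@perm_trans _ [seq eig n k | k <- iota 0 n]).
    apply: prod_XsubC_eq; rewrite [LHS]big_map [RHS]big_map big_enum /=.
    rewrite -(char_poly_orthogonal L GTG) -BE char_poly_mds_B_circle.
    by rewrite -(big_mkord xpredT (fun k => 'X - (eig n k)%:P)) /index_iota subn0.
  apply: perm_trans perm_rest _; rewrite perm_cat2l perm_sym perm_sort //.
move=> i; have -> : L 0 i = nth 0 [seq L 0 i | i <- enum 'I_n] i.
  by rewrite (nth_map i) ?size_enum_ord // nth_ord_enum.
rewrite LE nth_cat size_map size_iota; have [i_lt|i_ge] := ltnP i (npos n).
  by rewrite (nth_map 0%N) ?size_iota // nth_iota ?add0n.
(* Out of range [nth] returns 0, which satisfies the bound too. *)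
have [le_sz|lt_sz] := leqP (size (sort >=%O rest)) (i - npos n).
  by rewrite nth_default.
by have := mem_nth 0 lt_sz; rewrite mem_sort => /(allP rest_le0).
Qed.
End Order.

(** * Orthonormal waves and the rotated curve *)

Lemma sinusoid_root (R : realType) (a b : R) : exists psi, cos psi * a = sin psi * b.
Proof.
have [->|b0] := eqVneq b 0.
  by exists (pi / 2); rewrite cos_pihalf mul0r mulr0.
exists (atan (a / b)); have c0 : cos (atan (a / b)) != 0.
  by rewrite gt_eqF // cos_gt0_pihalf // atan_gtNpi2 atan_ltpi2.
have := atanK (a / b); rewrite /tan => /(congr1 (fun z => z * cos (atan (a / b)) * b)).
by rewrite divfK // => ->; rewrite mulrAC divfK // mulrC.
Qed.

Lemma rigid_motion_orthogonal (R : realType) (m : nat) (Q : 'M[R]_m) :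
  Q^T *m Q = 1%:M -> rigid_motion (fun x : 'rV_m => x *m Q).
Proof.
move=> /mulmx1C QQT x y; rewrite /eucl_dist; congr Num.sqrt.
have sq (z : 'rV[R]_m) : \sum_k z 0 k ^+ 2 = (z *m z^T) 0 0.
  by rewrite mxE; apply: eq_bigr => k _; rewrite mxE expr2.
transitivity (\sum_k ((x - y) *m Q) 0 k ^+ 2).
  by apply: eq_bigr => k _; rewrite mulmxBl !mxE.
rewrite sq trmx_mul mulmxA -(mulmxA _ Q) QQT mulmx1 -sq.
by apply: eq_bigr => k _; rewrite !mxE.
Qed.

Section Embedding.
Variables (R : realType) (m n : nat) (phi : R).

(** Rotating the circle by [phi] shifts the phase by frequency times [phi]; odd positions are sines,
    written as cosines delayed by [pi / 2]. *)
Definition curve_phase (l : nat) : R := (freq l)%:R * phi - (odd l)%:R * (pi / 2).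

Definition wave_mx : 'M[R]_(n, m) :=
  \matrix_(t, l) (wave_scale n (freq l) * wave n (freq l) (curve_phase l) t).

(** At frequency [n / 2] the wave is the alternating vector times the cosine of its phase, so a
    general phase would shrink it. That frequency occurs only when [m = n / 2], hence the condition
    on [phi]. *)
Lemma wave_mx_orthonormal : (m <= npos n)%N -> (m.*2 == n -> phi = 0) ->
  wave_mx^T *m wave_mx = 1%:M.
Proof.
move=> mP phi0; apply/matrixP => k l; rewrite !mxE.
wlog lk : k l / (freq l <= freq k)%N => [hw|].
  have [lk|/ltnW kl] := leqP (freq l) (freq k); first exact: hw.
  by rewrite eq_sym -(hw _ _ kl); apply: eq_bigr => t _; rewrite mulrC !mxE.
have [kP lP] : (k < npos n)%N /\ (l < npos n)%N.
  by split; apply: leq_trans mP; exact: ltn_ord.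
have [kn ln] := (freq_le kP, freq_le lP).
have n_gt0 : (0 < n)%N by rewrite /freq in kn; lia.
have n0 : n%:R != 0 :> R by rewrite pnatr_eq0 -lt0n.
rewrite (eq_bigr (fun t : 'I_n => wave_scale n (freq k) * wave_scale n (freq l) *
    (wave n (freq k) (curve_phase k) t * wave n (freq l) (curve_phase l) t))); last first.
  by move=> t _; rewrite !mxE mulrACA.
rewrite -mulr_sumr inner_wave //.
have [eq_f|neq_f] := eqVneq (freq k) (freq l); last first.
  have /negPf -> : k != l by apply: contraNneq neq_f => ->.
  by rewrite !gtnNdvd ?addr0 ?mulr0 //; lia.
have scale2 : wave_scale n (freq k) * wave_scale n (freq l) =
    (if (freq k).*2 == n then 1 else 2) / n%:R :> R.
  by rewrite -eq_f -expr2 sqr_sqrtr // divr_ge0 //; case: ifP.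
rewrite scale2 -eq_f subnn dvdn0 addnn.
have -> : (n %| (freq k).*2)%N = ((freq k).*2 == n).
  by apply/idP/eqP => [/dvdn_leq|->] //; rewrite /freq in kn *; lia.
have [->|kl] := eqVneq k l.
  rewrite subrr cos0; case: eqP => [kn2|_] /=; last by field.
  have l_even : ~~ odd l.
    by apply/negP => /freq_lt /(_ lP); rewrite kn2 ltnn.
  have phi_eq : phi = 0.
    by apply: phi0; have := ltn_ord l; rewrite /freq /npos in kn2 mP *; lia.
  by rewrite /curve_phase phi_eq (negPf l_even) mul0r mulr0 subr0 addr0 cos0; field.
have {}kl : k != l :> nat by rewrite val_eqE.
(* Two positions of one frequency are its cosine and its sine, with phases [pi / 2] apart. *)
have kl_odd : odd k != odd l by rewrite /freq in eq_f; lia.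
have /negPf -> : (freq k).*2 != n.
  rewrite neq_ltn; apply/orP; left.
  case ok : (odd k); first exact: freq_lt.
  by rewrite eq_f; apply: freq_lt => //; rewrite ok in kl_odd; lia.
have -> : curve_phase k - curve_phase l = ((odd l)%:R - (odd k)%:R) * (pi / 2).
  by rewrite /curve_phase eq_f; ring.
case: (odd k) (odd l) kl_odd => [] [] //= _.
  by rewrite sub0r mulN1r cosN cos_pihalf !(addr0, mulr0).
by rewrite subr0 mul1r cos_pihalf !(addr0, mulr0).
Qed.

Lemma wave_mx_gamma (i : 'I_n) :
  row i (wave_mx *m diag_mx (\row_(l < m) Num.sqrt (eig n (freq l)))) =
  gamma (fun j => curve_coef j n) m (circle_pt R i + phi).
Proof.
apply/rowP => l; rewrite mul_mx_diag !mxE /= -/(freq l) /curve_coef mulrAC.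
rewrite [_ * Num.sqrt _]mulrC; congr (_ * _); rewrite /wave /curve_phase /circle_pt.
have -> : 2 * pi * (freq l)%:R / n%:R * i%:R + ((freq l)%:R * phi - (odd l)%:R * (pi / 2))
   = (freq l)%:R * (2 * pi * i%:R / n%:R + phi) - (odd l)%:R * (pi / 2) by ring.
by case: odd; rewrite ?mul1r ?cosBpihalf // mul0r subr0.
Qed.

End Embedding.

(** Evaluating the product of column [k] of [G], [B] and the wave from either side gives two
    multiples of the same inner product, by different eigenvalues. *)
Lemma eigenvector_orthogonal (R : realType) (n : nat) (G : 'M[R]_n) (L : 'rV[R]_n)
    (k : 'I_n) (j : nat) (psi : R) :
  sorted_eigendecomposition (mds_B (circle_dist_mx R n)) G L -> (j < n)%N ->
  L 0 k != eig n j -> \sum_t G t k * wave n j psi t = 0.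
Proof.
move=> [GTG BE _] jn Lk; pose v : 'cV[R]_n := \col_t wave n j psi t.
have Bv : mds_B (circle_dist_mx R n) *m v = eig n j *: v.
  apply/colP => t; rewrite !mxE -mds_B_wave //.
  by apply: eq_bigr => s _; rewrite [v _ _]mxE.
have := congr1 (mulmx G^T) Bv; rewrite {1}BE !mulmxA GTG mul1mx -mulmxA -scalemxAr.
move=> /colP/(_ k); rewrite mul_diag_mx [LHS]mxE [RHS]mxE => /eqP.
rewrite -subr_eq0 -mulrBl mulf_eq0 subr_eq0 (negPf Lk) /= mxE => /eqP z0; rewrite -[RHS]z0.
by apply: eq_bigr => t _; rewrite !mxE.
Qed.

(* The last coordinate for odd m uses only one of the two eigenvectors of
   frequency m; the rotation phi of the circle makes the curve's coordinate
   orthogonal to the other one. *)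
Lemma wave_mx_orthogonal_rest (R : realType) (m n : nat) (G : 'M[R]_n) (L : 'rV[R]_n) :
  (0 < m)%N -> (m <= npos n)%N ->
  sorted_eigendecomposition (mds_B (circle_dist_mx R n)) G L ->
  exists2 phi : R, (m.*2 == n -> phi = 0) &
    forall (k : 'I_n) (l : 'I_m), (m <= k)%N -> (G^T *m wave_mx m n phi) k l = 0.
Proof.
move=> m_gt0 mP dec.
have [phi phi0 phiP] : exists2 phi : R, (m.*2 == n -> phi = 0) &
    odd m -> m.*2 != n -> forall k : 'I_n, k = m :> nat ->
    \sum_t G t k * wave n m (m%:R * phi) t = 0.
  (* When [m = n / 2] no eigenspace is cut, and when [m >= n] there is no column of index [m]. *)
  have [/eqP mn|mn] := boolP (m.*2 == n); first by exists 0.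
  have [m_lt|m_ge] := ltnP m n; last first.
    by exists 0 => // _ _ k km; have := ltn_ord k; rewrite km; lia.
  pose k := Ordinal m_lt; pose w : R := 2 * pi * m%:R / n%:R.
  (* Orthogonality to column [m] is one homogeneous linear equation in [cos psi] and [sin psi]. At
     frequency [m] a rotation by [psi / m] produces the phase [psi]. *)
  have [psi psiP] := sinusoid_root (\sum_t G t k * cos (w * t%:R))
    (\sum_t G t k * sin (w * t%:R)).
  exists (psi / m%:R) => [/eqP|_ _ k' km]; first by move/eqP: mn.
  have -> : k' = k by exact: val_inj.
  rewrite mulrC divfK ?pnatr_eq0 -?lt0n //; move/eqP: psiP; rewrite -subr_eq0 => /eqP z0.
  rewrite -[RHS]z0 !mulr_sumr -sumrB; apply: eq_bigr => t _.
  by rewrite /wave cosD -/w; ring.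
exists phi => // k l mk; rewrite mxE.
have ml := ltn_ord l; have lP : (l < npos n)%N := leq_trans ml mP.
have ln : (freq l < n)%N by have := freq_le lP; rewrite /freq; lia.
suff inner0 : \sum_t G t k * wave n (freq l) (curve_phase phi l) t = 0.
  rewrite -[RHS](mulr0 (wave_scale n (freq l))) -[in RHS]inner0 mulr_sumr.
  by apply: eq_bigr => t _; rewrite !mxE; ring.
have [Lk|] := eqVneq (L 0 k) (eig n (freq l)); last exact: eigenvector_orthogonal.
have l_gt0 : 0 < eig n (freq l) :> R by rewrite eig_gt0 ?odd_freq ?freq_le.
have := circle_spectrum dec k; case: ifP => [kP|_]; last first.
  by rewrite Lk leNgt l_gt0.
rewrite Lk => eq_eig.
have [lt_f|ge_f] := ltnP (freq l) (freq k).
  have := @eig_lt R n _ _ (odd_freq l) (odd_freq k) lt_f (freq_le kP).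
  by rewrite eq_eig ltxx.
(* Since [l < m <= k], a shared frequency forces [k = m] odd and [l = m - 1]: the eigenspace cut by
   [m]. *)
have [om km lm ol] : [/\ odd m, k = m :> nat, freq l = m & odd l = false].
  by rewrite /freq in ge_f *; split; lia.
rewrite /curve_phase lm ol mul0r subr0; apply: phiP => //.
by move: kP; rewrite /npos; lia.
Qed.

(** * Assembly of the rigid motion *)

Lemma big_ord_widen_zero (V : nmodType) (m n : nat) (le_mn : (m <= n)%N) (F : 'I_n -> V) :
  (forall k : 'I_n, (m <= k)%N -> F k = 0) ->
  \sum_k F k = \sum_(k < m) F (widen_ord le_mn k).
Proof.
move=> F0; rewrite (bigID (fun k : 'I_n => (k < m)%N)) /= [X in _ + X]big1.
  by rewrite addr0 (big_ord_narrow le_mn).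
by move=> k; rewrite -leqNgt; exact: F0.
Qed.

Theorem proposition5p1 (R : realType) :
  exists a : nat -> nat -> R,
    (forall j : nat, odd j ->
       (fun n : nat => a j n) @ \oo --> Num.sqrt 2 / j%:R) /\
    (forall m n : nat, (1 <= m)%N -> (1 <= n)%N ->
       at_least_pos_eigenvalues m (mds_B (circle_dist_mx R n)) ->
       forall X : 'M[R]_(n, m), classical_mds (circle_dist_mx R n) X ->
       exists f : 'rV[R]_m -> 'rV[R]_m,
         rigid_motion f /\
         forall i : 'I_n, exists theta : R,
           f (row i X) = gamma (fun j => a j n) m theta).
Proof.
exists curve_coef; split; first exact: cvg_curve_coef.
move=> m n m_gt0 n_gt0 /at_least_pos_eigenvalues_circle mP X [G [L [le_mn [dec ->]]]].
have [phi phi0 rest0] := wave_mx_orthogonal_rest m_gt0 mP dec.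
have [GTG _ _] := dec; set U := wave_mx m n phi in rest0.
set Gm := colsub _ G; pose Q := Gm^T *m U.
have L_eig (k : 'I_m) : L 0 (widen_ord le_mn k) = eig n (freq k).
  by have := circle_spectrum dec (widen_ord le_mn k); rewrite /= (leq_trans (ltn_ord k) mP).
have QE k l : Q k l = (G^T *m U) (widen_ord le_mn k) l.
  by rewrite !mxE; apply: eq_bigr => t _; rewrite !mxE.
(* The columns of [U] are orthogonal to those of [G] beyond [m], so projecting onto the first [m]
   columns leaves them fixed. *)
have GmQ : Gm *m Q = U.
  rewrite -[RHS]mul1mx -(mulmx1C GTG) -mulmxA; apply/matrixP => t l.
  rewrite mxE [RHS]mxE (big_ord_widen_zero le_mn) => [|k mk]; last by rewrite rest0 ?mulr0.
  by apply: eq_bigr => k _; rewrite QE mxE.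
have QTQ : Q^T *m Q = 1%:M.
  by rewrite {1}/Q trmx_mul trmxK -mulmxA GmQ wave_mx_orthonormal.
set S := diag_mx _.
have SE : S = diag_mx (\row_(l < m) Num.sqrt (eig n (freq l))).
  by congr diag_mx; apply/rowP => k; rewrite !mxE L_eig.
(* An entry of [Q] linking distinct eigenvalues is zero, so [Q] commutes with their square roots. *)
have SQ : S *m Q = Q *m S.
  rewrite SE; apply/matrixP => k l; rewrite mul_diag_mx mul_mx_diag mxE [RHS]mxE !mxE.
  have [->|neq] := eqVneq (eig n (freq k)) (eig n (freq l) : R); first by rewrite mulrC.
  rewrite (_ : \sum_j _ = 0) ?mulr0 ?mul0r //.
  have lP : (l < npos n)%N := leq_trans (ltn_ord l) mP.
  rewrite -[RHS](mulr0 (wave_scale n (freq l))).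
  rewrite -[in RHS](@eigenvector_orthogonal _ _ _ _ (widen_ord le_mn k) (freq l)
    (curve_phase phi l) dec).
  - by rewrite mulr_sumr; apply: eq_bigr => t _; rewrite !mxE mulrCA.
  - by have := freq_le lP; rewrite /freq; lia.
  - by rewrite L_eig.
exists (fun x => x *m Q); split; first exact: rigid_motion_orthogonal.
move=> i; exists (circle_pt R i + phi).
(* The motion sends [Gm *m S] to [Gm *m S *m Q = Gm *m Q *m S = U *m S], whose rows lie on the
   curve. *)
by rewrite -row_mul -mulmxA SQ mulmxA GmQ SE wave_mx_gamma.
Qed.
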